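(* Let $M,N\in\mathbb N$ with $N<M<2N$ and let $\lambda=\frac MN$. The following are equivalent: (i) STC, run with all $N$ eigenvalues equal to $\lambda$, successfully produces a unit norm tight frame $(f_m)_{m=1}^M$ for $\mathbb R^N$. (ii) For all $1\le k\le N-1$, if $k\lambda$ is not an integer, then $\lfloor k\lambda\rfloor\le(k+1)\lambda-2$, where $\lfloor x\rfloor$ is the greatest integer less than or equal to $x$.
   Context: A sequence $(f_m)_{m=1}^M$ in $\mathbb R^N$ is a unit norm tight frame if $\|f_m\|=1$ for all $m$ and $FF^*=\frac MN I$, where $F$ is the $N\times M$ matrix with columns $f_1,\dots,f_M$. The STC (Spectral Tetris) algorithm, run on an ordered sequence $(\lambda_n)_{n=1}^N$ of positive reals with $\sum_{n=1}^N\lambda_n=M\in\mathbb N$. Let $(e_n)_{n=1}^N$ be the standard basis of $\mathbb R^N$. Keep residuals $r_1,\dots,r_N$, initially $r_n=\lambda_n$, and a counter $m$, initially $m=1$. For $n=1,\dots,N$ in this order, as long as $r_n>0$ repeat the following step. - If $r_n\ge1$: set $f_m=e_n$, replace $r_n$ by $r_n-1$, and $m$ by $m+1$. - If $r_n<1$: set $f_m=\sqrt{\frac{r_n}2}\,e_n+\sqrt{1-\frac{r_n}2}\,e_{n+1}$ and $f_{m+1}=\sqrt{\frac{r_n}2}\,e_n-\sqrt{1-\frac{r_n}2}\,e_{n+1}$, then replace $r_{n+1}$ by $r_{n+1}-(2-r_n)$, $r_n$ by $0$, and $m$ by $m+2$. The run is successful if $n+1\le N$ whenever $e_{n+1}$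 is used and no residual ever becomes negative; the output is then $(f_m)_{m=1}^M$. *)

(* Defs.v *)
From HB Require Import structures.
From mathcomp Require Import all_boot all_order all_algebra.
From mathcomp Require Import reals.

Set Implicit Arguments.
Unset Strict Implicit.
Unset Printing Implicit Defensive.

Import Order.TTheory GRing.Theory Num.Theory.
Local Open Scope ring_scope.

(* The norm that MathComp-Analysis puts on matrices is the max norm, hence this
   definition of the Euclidean norm. *)
Definition enorm (R : realType) (N : nat) (v : 'cV[R]_N) : R :=
  Num.sqrt (\sum_i v i 0 ^+ 2).

Definition synthesis_mx (R : realType) (N M : nat) (f : M.-tuple 'cV[R]_N) :
    'M[R]_(N, M) :=
  \matrix_(i < N, m < M) tnth f m i 0.

Definition unit_norm_tight_frame (R : realType) (N M : nat)
    (f : M.-tuple 'cV[R]_N) : Prop :=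
  (forall m : 'I_M, enorm (tnth f m) = 1) /\
  synthesis_mx f *m (synthesis_mx f)^T = (M%:R / N%:R)%:M.

Definition basis_vec (R : realType) (N : nat) (n : 'I_N) : 'cV[R]_N :=
  delta_mx n 0.

(* [stc_run n r fs]: when the loop is at index [n] (counted from 0, so that
   [n = N] means that the loop is over) with residuals [r], the rest of the run
   is successful and emits exactly the vectors [fs], in this order.  The counter
   m of the algorithm is the position in the emitted sequence.
   An unsuccessful run has no derivation: [stc_pair] demands that the index
   n + 1 exists and that the decreased residual r_{n+1} is not negative, the only
   assignment that could make a residual negative.  The rules exclude each other,
   so [n] and [r] determine [fs]. *)
Inductive stc_run (R : realType) (N : nat) :
    nat -> ('I_N -> R) -> seq 'cV[R]_N -> Prop :=
| stc_done (r : 'I_N -> R) :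
    stc_run N r [::]
| stc_next (n : 'I_N) (r : 'I_N -> R) (fs : seq 'cV[R]_N) :
    r n <= 0 ->
    stc_run n.+1 r fs ->
    stc_run n r fs
| stc_single (n : 'I_N) (r : 'I_N -> R) (fs : seq 'cV[R]_N) :
    1 <= r n ->
    stc_run n [eta r with n |-> r n - 1] fs ->
    stc_run n r (basis_vec R n :: fs)
| stc_pair (n n' : 'I_N) (r : 'I_N -> R) (fs : seq 'cV[R]_N) :
    0 < r n < 1 ->
    n' = n.+1 :> nat ->
    0 <= r n' - (2 - r n) ->
    stc_run n [eta r with n |-> 0, n' |-> r n' - (2 - r n)] fs ->
    stc_run n r
      [:: Num.sqrt (r n / 2) *: basis_vec R n
            + Num.sqrt (1 - r n / 2) *: basis_vec R n',
          Num.sqrt (r n / 2) *: basis_vec R n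
            - Num.sqrt (1 - r n / 2) *: basis_vec R n'
        & fs].

Definition stc_output (R : realType) (N M : nat) (lam : 'I_N -> R)
    (f : M.-tuple 'cV[R]_N) : Prop :=
  stc_run 0 lam f.

(* Main.v *)
(** With indices counted from 0, the residual reached at index n is
    r_n = (n+1) lambda - m, where m counts the vectors emitted so far.  Removing
    units from it, a pair is needed at n exactly when k lambda is not an
    integer, k = n+1, and m is then the floor of k lambda.  The pair leaves
    (k+1) lambda - floor (k lambda) - 2 to the next index, so the run survives
    index n iff (ii) holds at k.  At k = N no pair is needed, since
    N lambda = M.
    Moreover the frame operator of the vectors emitted by a successful run is
    the diagonal of the initial residuals: the cross terms of the two vectors
    of a pair cancel. *)
Require Import Defs.
From HB Require Import structures.
From mathcomp Require Import all_boot all_order all_algebra.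
From mathcomp Require Import reals.
From mathcomp Require Import ring lra zify.

Set Implicit Arguments.
Unset Strict Implicit.
Unset Printing Implicit Defensive.

Import Order.TTheory GRing.Theory Num.Theory.
Local Open Scope ring_scope.

(** * Norms, frame operator and number of the emitted vectors *)

Lemma basis_vecE (R : realType) (N : nat) (n i : 'I_N) :
  basis_vec R n i 0 = (i == n)%:R.
Proof. by rewrite mxE eqxx andbT. Qed.

Lemma enorm_basis_vec (R : realType) (N : nat) (n : 'I_N) :
  enorm (basis_vec R n) = 1.
Proof.
rewrite /enorm (bigD1 n) //= big1 => [|i /negbTE in_n];
  rewrite basis_vecE ?in_n ?expr0n //.
by rewrite eqxx expr1n addr0 sqrtr1.
Qed.

Lemma enorm_basis_vec2 (R : realType) (N : nat) (n n' : 'I_N) (a b : R) :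
  n != n' ->
  enorm (a *: basis_vec R n + b *: basis_vec R n')
  = Num.sqrt (a ^+ 2 + b ^+ 2).
Proof.
move=> nn'; rewrite /enorm; congr Num.sqrt.
rewrite (bigD1 n) //= (bigD1 n') 1?eq_sym //=.
rewrite big1 => [|i /andP[/negbTE hn /negbTE hn']].
  rewrite !mxE !eqxx (negbTE nn') eq_sym (negbTE nn') /=; ring.
by rewrite !mxE hn hn' /= !mulr0 addr0 expr0n.
Qed.

Lemma stc_run_enorm (R : realType) (N n : nat) (r : 'I_N -> R)
    (fs : seq 'cV[R]_N) :
  stc_run n r fs -> {in fs, forall v, enorm v = 1}.
Proof.
elim=> {n r fs} [r|n r fs _ _ IH|n r fs _ _ IH|n n' r fs r_n n'E _ _ IH] //.
  by move=> v /[!inE] /orP[/eqP->|/IH//]; exact: enorm_basis_vec.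
have nn' : n != n' by apply/eqP => nn'; move: n'E; rewrite nn'; lia.
have norm1 : Num.sqrt (r n / 2) ^+ 2 + Num.sqrt (1 - r n / 2) ^+ 2 = 1.
  by rewrite !sqr_sqrtr; lra.
move=> v /[!inE] /or3P[/eqP->|/eqP->|/IH//];
  rewrite -?scaleNr enorm_basis_vec2 //.
  by rewrite norm1 sqrtr1.
by rewrite sqrrN norm1 sqrtr1.
Qed.

(** Induction on the run. A run from index [n] never touches coordinates below [n], hence the factor
    [n <= i]. Nonnegativity is what turns the premise [r n <= 0] of [stc_next] into [r n = 0], so
    that nothing is lost when the loop leaves [n]. *)
Lemma stc_run_frame_operator (R : realType) (N n : nat) (r : 'I_N -> R)
    (fs : seq 'cV[R]_N) :
  stc_run n r fs -> (forall j : 'I_N, (n <= j)%N -> 0 <= r j) ->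
  forall i j : 'I_N,
    \sum_(v <- fs) v i 0 * v j 0 = r i *+ ((i == j) && (n <= i)%N).
Proof.
elim=> {n r fs} [r|n r fs r_n _ IH|n r fs r_n _ IH|n n' r fs r_n n'E r_n' _ IH]
  r_ge0 i j.
- by rewrite big_nil leqNgt ltn_ord andbF.
- rewrite IH => [|k ltnk]; last exact: r_ge0 (ltnW ltnk).
  have [->|ni] := eqVneq i n; last first.
    by rewrite ltn_neqAle eq_sym -val_eqE in ni *; rewrite ni.
  have -> : r n = 0 by apply/le_anti; rewrite r_n r_ge0.
  by rewrite !mul0rn.
- rewrite big_cons !basis_vecE IH => [|k lenk] /=; last first.
    by case: eqP => _; [rewrite subr_ge0 | exact: r_ge0].
  have [->|ni] := eqVneq i n; last by rewrite mul0r add0r.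
  rewrite leqnn andbT [j == n]eq_sym.
  by case: eqVneq => _ /=; ring.
have nn' : (n' == n) = false by apply/eqP => nn'; move: n'E; rewrite nn'; lia.
rewrite !big_cons IH => [|k lenk] /=; last first.
  by case: eqP => // _; case: eqP => // _; exact: r_ge0.
have sq1 : Num.sqrt (r n / 2) ^+ 2 = r n / 2 by rewrite sqr_sqrtr; lra.
have sq2 : Num.sqrt (1 - r n / 2) ^+ 2 = 1 - r n / 2 by rewrite sqr_sqrtr; lra.
rewrite !mxE !eqxx !andbT.
set a := Num.sqrt _ in sq1 *; set b := Num.sqrt _ in sq2 *.
(* In the contribution [s] of the pair the products [a * b] cancel. What remains is
   [2 * a ^+ 2 = r n] at [(n, n)] and [2 * b ^+ 2 = 2 - r n] at [(n', n')], exactly what the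
   residuals lose. *)
rewrite addrA; set s := (X in X + _ = _).
have {s}-> : s = r n * (i == n)%:R * (j == n)%:R
                 + (2 - r n) * (i == n')%:R * (j == n')%:R.
  have -> : r n = 2 * a ^+ 2 by rewrite sq1; field.
  have -> : 2 - 2 * a ^+ 2 = 2 * b ^+ 2 by rewrite sq1 sq2; field.
  rewrite /s; ring.
have [->|ni] := eqVneq i n.
  rewrite leqnn [n == n']eq_sym nn' andbT [j == n]eq_sym.
  by case: eqVneq => _ /=; ring.
have [->|n'i] := eqVneq i n'; last by rewrite /= !mulr0 !mul0r !add0r.
rewrite n'E leqnSn andbT [j == n']eq_sym.
by case: eqVneq => _ /=; ring.
Qed.

(** The trace of the frame operator is both the sum of the residuals and the sum of the squared
    norms, all equal to 1. This is how the output is seen to have length [M]. *)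
Lemma stc_run_size (R : realType) (N : nat) (r : 'I_N -> R)
    (fs : seq 'cV[R]_N) :
  stc_run 0 r fs -> (forall j, 0 <= r j) -> (size fs)%:R = \sum_j r j.
Proof.
move=> run r_ge0.
have frame := stc_run_frame_operator run (fun j _ => r_ge0 j).
under eq_bigr => i _.
  have -> : r i = \sum_(v <- fs) v i 0 * v i 0 by rewrite frame eqxx.
  over.
rewrite exchange_big /= (eq_big_seq (fun=> 1)) => [|v fs_v].
  by rewrite big_const_seq count_predT iter_addr_0.
have norm_v := stc_run_enorm run fs_v.
under eq_bigr do rewrite -expr2.
rewrite -[LHS]sqr_sqrtr ?sumr_ge0 // => [|i _]; last exact: sqr_ge0.
by move: norm_v; rewrite /enorm => ->; rewrite expr1n.
Qed.

Lemma stc_output_tight_frame (R : realType) (M N : nat)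
    (f : M.-tuple 'cV[R]_N) :
  stc_output (fun=> M%:R / N%:R) f -> unit_norm_tight_frame f.
Proof.
move=> run; split=> [m|]; first exact: stc_run_enorm run _ (mem_tnth _ _).
apply/matrixP => i j; rewrite !mxE.
have ge0 (k : 'I_N) : (0 <= k)%N -> 0 <= M%:R / N%:R :> R by rewrite divr_ge0.
have := stc_run_frame_operator run ge0 i j.
rewrite andbT big_tuple => <-.
by apply: eq_bigr => m _; rewrite !mxE.
Qed.

(** * When a run succeeds *)

Definition stc_succeeds (R : realType) (N n : nat) (r : 'I_N -> R) : Prop :=
  exists fs, stc_run n r fs.

(** The value [r n] leaves only one applicable rule, so inversion makes each rule an equivalence,
    here and in the next two lemmas. *)
Lemma stc_succeeds_next (R : realType) (N : nat) (n : 'I_N) (r : 'I_N -> R) :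
  r n <= 0 -> stc_succeeds n r <-> stc_succeeds n.+1 r.
Proof.
move=> r_n; split=> -[fs run]; last by exists fs; exact: stc_next.
inversion run as [r0 nE|n0 r0 fs0 _ run0 nE|n0 r0 fs0 r_n0 _ nE|
                  n0 n' r0 fs0 r_n0 _ _ _ nE].
- by have := ltn_ord n; rewrite -nE ltnn.
- by exists fs.
- by move: r_n0; rewrite (val_inj nE); lra.
- by move: r_n0; rewrite (val_inj nE); lra.
Qed.

Lemma stc_succeeds_single (R : realType) (N : nat) (n : 'I_N) (r : 'I_N -> R) :
  1 <= r n ->
  stc_succeeds n r <-> stc_succeeds n [eta r with n |-> r n - 1].
Proof.
move=> r_n; split=> -[fs run]; last first.
  by exists (basis_vec R n :: fs); exact: stc_single.
inversion run as [r0 nE|n0 r0 fs0 r_n0 _ nE|n0 r0 fs0 _ run0 nE|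
                  n0 n' r0 fs0 r_n0 _ _ _ nE].
- by have := ltn_ord n; rewrite -nE ltnn.
- by move: r_n0; rewrite (val_inj nE); lra.
- by exists fs0; rewrite -(val_inj nE).
- by move: r_n0; rewrite (val_inj nE); lra.
Qed.

Lemma stc_succeeds_pair (R : realType) (N : nat) (n n' : 'I_N)
    (r : 'I_N -> R) :
  0 < r n < 1 -> n' = n.+1 :> nat ->
  stc_succeeds n r <->
  0 <= r n' - (2 - r n) /\
  stc_succeeds n' [eta r with n |-> 0, n' |-> r n' - (2 - r n)].
Proof.
(* The pair leaves residual 0 at [n], so the move on to [n'] is absorbed into the statement. *)
move=> r_n n'E; rewrite n'E -stc_succeeds_next /=; last by rewrite eqxx.
split=> [[fs run]|[r_n' [fs run]]]; last by eexists; exact: stc_pair run.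
inversion run as [r0 nE|n0 r0 fs0 r_n0 _ nE|n0 r0 fs0 r_n0 _ nE|
                  n0 n1 r0 fs0 _ n1E r_n1 run0 nE].
- by have := ltn_ord n; rewrite -nE ltnn.
- by move: r_n0; rewrite (val_inj nE); lra.
- by move: r_n0; rewrite (val_inj nE); lra.
- have n0E := val_inj nE.
  have n1n' : n1 = n' by apply: val_inj; rewrite /= n1E nE n'E.
  by subst n0 n1; split=> //; exists fs0.
Qed.

Definition floor_condition (R : realType) (lambda : R) (k : nat) : Prop :=
  k%:R * lambda \isn't a Num.int ->
  (Num.floor (k%:R * lambda))%:~R <= (k + 1)%:R * lambda - 2.

(** The loop invariant: later residuals are untouched, and the current one is determined by [n] and
    the count [m]. Quantifying over [j = n] makes it vacuous at [n = N]. A pair at index [n] tests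
    the condition at [k = n.+1], so the conditions still ahead are those with [n < k]. *)
Lemma stc_succeeds_floor (R : realType) (M N : nat) (lambda : R) :
  0 <= lambda -> N%:R * lambda = M%:R ->
  forall (n m : nat) (r : 'I_N -> R),
  (forall j : 'I_N, (n < j)%N -> r j = lambda) ->
  (forall j : 'I_N, j = n :> nat ->
     r j = n.+1%:R * lambda - m%:R /\ 0 <= r j) ->
  (n <= N)%N ->
  stc_succeeds n r <->
  (forall k, (n < k < N)%N -> floor_condition lambda k).
Proof.
move=> lambda_ge0 NlambdaE n m.
have [s] := ubnP (N + M - (n + m)); elim: s n m => // s IH n m les r rE rn lenN.
have [nN|nN] := eqVneq n N.
  split=> [_ k|_]; first lia.
  by exists [::]; rewrite nN; exact: stc_done.
have ltnN : (n < N)%N by rewrite ltn_neqAle nN.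
pose i := Ordinal ltnN; have [riE ri_ge0] := rn i erefl.
(* Every rule increases [n + m]; with [n < N] and [m <= M] the truncated difference
   [N + M - (n + m)] then strictly decreases. *)
have lemM : (m <= M)%N.
  rewrite -(ler_nat R) -NlambdaE.
  have : n.+1%:R * lambda <= N%:R * lambda by rewrite ler_wpM2r // ler_nat.
  lra.
have cond_split :
    (forall k, (n < k < N)%N -> floor_condition lambda k) <->
    ((n.+1 < N)%N -> floor_condition lambda n.+1) /\
    (forall k, (n.+1 < k < N)%N -> floor_condition lambda k).
  split=> [H|[H1 H] k hk]; first by split=> [?|k hk]; apply: H; lia.
  have [kE|kn] := eqVneq k n.+1; last by apply: H; lia.
  by rewrite kE; apply: H1; lia.
rewrite -[n]/(i : nat).
have [ri1|ri1] := leP 1 (r i).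
  rewrite stc_succeeds_single //; apply: (IH _ m.+1) => //= [|j ltnj|j jn].
  - lia.
  - by case: eqP => [ji|_]; [move: ltnj; rewrite ji ltnn | exact: rE].
  - have -> : j = i by exact: val_inj.
    rewrite eqxx riE; split; last lra.
    by rewrite -[in RHS]natr1; ring.
have [ri0|ri_gt0] := leP (r i) 0.
  have lamE : n.+1%:R * lambda = m%:R by lra.
  rewrite stc_succeeds_next // cond_split.
  have cond_n1 : floor_condition lambda n.+1.
    by rewrite /floor_condition lamE natr_int.
  suff -> : stc_succeeds n.+1 r <->
      forall k, (n.+1 < k < N)%N -> floor_condition lambda k by tauto.
  apply: (IH _ m) => //= [|j ltnj|j jn]; [lia|apply: rE; lia|].
  rewrite rE ?jn //; split=> //.
  by rewrite -natr1 mulrDl lamE; ring.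
have floorE : Num.floor (n.+1%:R * lambda) = m%:Z.
  by apply: floor_def; rewrite -pmulrn intrD -pmulrn; apply/andP; split; lra.
have notint : n.+1%:R * lambda \isn't a Num.int.
  by rewrite intrEfloor floorE -pmulrn; apply/eqP; lra.
(* At the last index [n.+1 = N], and [N%:R * lambda] is an integer; so the neighbour [i'] needed by
   the pair exists. *)
have ltn1N : (n.+1 < N)%N.
  rewrite ltn_neqAle ltnN andbT; apply: contraNneq notint => ->.
  by rewrite NlambdaE natr_int.
pose i' := Ordinal ltn1N.
rewrite (@stc_succeeds_pair _ _ i i') ?ri_gt0 // (rE i') //= cond_split.
have condE : 0 <= lambda - (2 - r i) <-> floor_condition lambda n.+1.
  rewrite /floor_condition floorE riE -pmulrn addn1 -[n.+2%:R]natr1.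
  by split=> [H _|/(_ notint)]; lra.
(* The induction hypothesis requires a nonnegative residual at [n.+1], hence the premise; [condE]
   supplies it in both directions. *)
have rest : 0 <= lambda - (2 - r i) ->
    stc_succeeds n.+1 [eta r with i |-> 0, i' |-> lambda - (2 - r i)] <->
    forall k, (n.+1 < k < N)%N -> floor_condition lambda k.
  move=> ge0; apply: (IH _ m.+2) => //= [|j ltnj|j jn].
  - lia.
  - by rewrite !ifF ?rE //; try (apply/eqP => ji; move: ltnj; rewrite ji /=);
      lia.
  - have -> : j = i' by exact: val_inj.
    rewrite eqxx ifF; last by apply/eqP => /(congr1 val) /=; lia.
    split=> //; rewrite riE -[n.+2%:R]natr1 -[m.+2%:R]natr1 -[m.+1%:R]natr1.
    ring.
by tauto.
Qed.

Theorem theorem4p1 (R : realType) (M N : nat) (lambda : R)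
    (hNM : (N < M < 2 * N)%N) (hlambda : lambda = M%:R / N%:R) :
  (exists f : M.-tuple 'cV[R]_N,
     stc_output (fun _ : 'I_N => lambda) f /\ unit_norm_tight_frame f)
  <->
  (forall k : nat, (1 <= k <= N - 1)%N ->
     k%:R * lambda \isn't a Num.int ->
     (Num.floor (k%:R * lambda))%:~R <= (k + 1)%:R * lambda - 2).
Proof.
have N_gt0 : (0 < N)%N by lia.
have lambda_ge0 : 0 <= lambda by rewrite hlambda divr_ge0.
have NlambdaE : N%:R * lambda = M%:R.
  by rewrite hlambda mulrCA divff ?mulr1 // pnatr_eq0; lia.
have init (j : 'I_N) : j = 0%N :> nat ->
    lambda = 1%:R * lambda - 0%:R /\ 0 <= lambda by rewrite mul1r subr0.
(* At the start [n = m = 0], and the range [0 < k < N] is that of (ii). *)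
have succE := @stc_succeeds_floor R M N lambda lambda_ge0 NlambdaE 0 0
  (fun=> lambda) (fun _ _ => erefl) init (leq0n N).
split=> [[f [run _]] k hk|cond].
  by apply: (succE.1 _ k); [exists f | lia].
have [|fs run] := succE.2 _; first by move=> k hk; apply: cond; lia.
have size_fs : size fs == M.
  rewrite -(eqr_nat R) (stc_run_size run) // sumr_const card_ord.
  by rewrite -[lambda *+ N]mulr_natl NlambdaE.
exists (Tuple size_fs); split=> //.
by apply: stc_output_tight_frame; rewrite -hlambda.
Qed.
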